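(* Let $M\in\mathbb{C}^{n\times n}$ be a non-zero multiple of a unitary matrix, let $\mathcal{A}\in\mathbb{C}^{m\times p\times n}$ have t-SVDM $\mathcal{A}=\mathcal{U}\star_M\mathcal{S}\star_M\mathcal{V}^{\rm H}$, and let $r$ be the t-rank of $\mathcal{A}$ under $\star_M$. For $1\le k\le \min(m,p)$ define $$\mathcal{A}_k=\mathcal{U}_{:,1:k,:}\star_M\mathcal{S}_{1:k,1:k,:}\star_M\mathcal{V}_{:,1:k,:}^{\rm H}.$$ Then $\mathcal{A}_k$ is a best Frobenius norm approximation to $\mathcal{A}$ (i.e. it minimizes $\|\mathcal{A}-\mathcal{C}\|_F$) over the set $$\Gamma=\{\mathcal{C}=\mathcal{X}\star_M\mathcal{Y}\;:\;\mathcal{X}\in\mathbb{C}^{m\times k\times n},\ \mathcal{Y}\in\mathbb{C}^{k\times p\times n}\},$$ and the squared error is $$\|\mathcal{A}-\mathcal{A}_k\|_F^2=\sum_{i=k+1}^{r}\|\mathbf{s}_i\|_F^2,\qquad \mathbf{s}_i:=\mathcal{S}_{i,i,:}.$$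
   Context: MATLAB index notation is used for third-order arrays. $\|\mathcal{A}\|_F^2=\sum_{i,j,k}|\mathcal{A}_{i,j,k}|^2$. For an invertible $n\times n$ matrix $M$ and $\mathcal{A}\in\mathbb{C}^{m\times p\times n}$, $\widehat{\mathcal{A}}=\mathcal{A}\times_3 M$ is the tensor of the same size obtained by applying $M$ to every tube: $\widehat{\mathcal{A}}_{i,j,k}=\sum_{l}M_{kl}\mathcal{A}_{i,j,l}$. For $\mathcal{A}\in\mathbb{C}^{m\times p\times n}$, $\mathcal{B}\in\mathbb{C}^{p\times q\times n}$, the product $\mathcal{C}=\mathcal{A}\star_M\mathcal{B}\in\mathbb{C}^{m\times q\times n}$ is defined by $\widehat{\mathcal{C}}_{:,:,i}=\widehat{\mathcal{A}}_{:,:,i}\widehat{\mathcal{B}}_{:,:,i}$ for $i=1,\dots,n$, and $\mathcal{C}=\widehat{\mathcal{C}}\times_3M^{-1}$. The conjugate transpose $\mathcal{A}^{\rm H}\in\mathbb{C}^{p\times m\times n}$ under $\star_M$ is defined by $(\widehat{\mathcal{A}^{\rm H}})_{:,:,i}=(\widehat{\mathcal{A}}_{:,:,i})^{\rm H}$. The t-SVDM of $\mathcal{A}$ is $\mathcal{A}=\mathcal{U}\star_M\mathcal{S}\star_M\mathcal{V}^{\rm H}$, where for each $i$, $\widehat{\mathcal{A}}_{:,:,i}=\widehat{\mathcal{U}}_{:,:,i}\widehat{\mathcal{S}}_{:,:,i}\widehat{\mathcal{V}}_{:,:,i}^{\rm H}$ is a (full) matrix SVD with singular values in non-increasing order on the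 diagonal, and $\mathcal{U},\mathcal{S},\mathcal{V}$ are obtained by applying $\times_3M^{-1}$. The t-rank of $\mathcal{A}$ is the number of non-zero tubes $\mathcal{S}_{i,i,:}$. *)

(* Defs.v *)
From HB Require Import structures.
From mathcomp Require Import all_boot all_order all_algebra.

Set Implicit Arguments.
Unset Strict Implicit.
Unset Printing Implicit Defensive.

Import Order.TTheory GRing.Theory Num.Theory.
Local Open Scope ring_scope.
Local Open Scope sesquilinear_scope.

(* A third-order array of size m x p x n is the family of its frontal slices:
   [A l] is A_{:,:,l} and [A l i j] is the entry A_{i,j,l}.  Indices are
   0-based. *)
Notation tensor C m p n := {ffun 'I_n -> 'M[C]_(m, p)}.

Section Tensors.
Variable C : numClosedFieldType.

Definition fnorm m p n (A : tensor C m p n) : C :=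
  sqrtC (\sum_i \sum_j \sum_l `|A l i j| ^+ 2).

(* A x_3 M : the matrix M is applied to every tube A_{i,j,:}. *)
Definition mode3 m p n (A : tensor C m p n) (M : 'M[C]_n) : tensor C m p n :=
  [ffun k => \matrix_(i, j) \sum_l M k l * A l i j].

Definition starM n (M : 'M[C]_n) m p q
    (A : tensor C m p n) (B : tensor C p q n) : tensor C m q n :=
  mode3 [ffun l => mode3 A M l *m mode3 B M l] (invmx M).

Definition ctranspM n (M : 'M[C]_n) m p (A : tensor C m p n) : tensor C p m n :=
  mode3 [ffun l => (mode3 A M l) ^t*] (invmx M).

Definition is_svd m p (A : 'M[C]_(m, p))
    (U : 'M[C]_m) (S : 'M[C]_(m, p)) (V : 'M[C]_p) : Prop :=
  [/\ U \is unitarymx, V \is unitarymx & A = U *m S *m V ^t*] /\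
  [/\ is_diag_mx S,
      forall (i : 'I_m) (j : 'I_p), i = j :> nat -> 0 <= S i j &
      forall (i i' : 'I_m) (j j' : 'I_p), i = j :> nat -> i' = j' :> nat ->
        (i <= i')%N -> S i' j' <= S i j].

Definition is_tsvdm n (M : 'M[C]_n) m p (A : tensor C m p n)
    (U : tensor C m m n) (S : tensor C m p n) (V : tensor C p p n) : Prop :=
  A = starM M (starM M U S) (ctranspM M V) /\
  forall l, is_svd (mode3 A M l) (mode3 U M l) (mode3 S M l) (mode3 V M l).

(* The tube S_{i,i,:}, as a 1 x 1 x n array. *)
Definition dtube m p n (S : tensor C m p n) (i : 'I_(minn m p)) :
    tensor C 1 1 n :=
  [ffun l => const_mx (S l (widen_ord (geq_minl m p) i)
                           (widen_ord (geq_minr m p) i))].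

(* The t-rank does not depend on the t-SVDM chosen: the diagonal entries of the
   transformed slices of S are the singular values of those of A. *)
Definition is_trank n (M : 'M[C]_n) m p (A : tensor C m p n) (r : nat) : Prop :=
  exists (U : tensor C m m n) (S : tensor C m p n) (V : tensor C p p n),
    is_tsvdm M A U S V /\ r = #|[set i | dtube S i != 0]|.

(* A_{:,1:k,:} *)
Definition tcols m p n k (hk : (k <= p)%N) (A : tensor C m p n) :
    tensor C m k n :=
  [ffun l => colsub (widen_ord hk) (A l)].

(* A_{1:k,1:k,:} *)
Definition tlead m p n k (hm : (k <= m)%N) (hp : (k <= p)%N)
    (A : tensor C m p n) : tensor C k k n :=
  [ffun l => mxsub (widen_ord hm) (widen_ord hp) (A l)].

Definition ttrunc n (M : 'M[C]_n) m p k (hk : (k <= minn m p)%N)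
    (U : tensor C m m n) (S : tensor C m p n) (V : tensor C p p n) :
    tensor C m p n :=
  let hm := leq_trans hk (geq_minl m p) in
  let hp := leq_trans hk (geq_minr m p) in
  starM M (starM M (tcols hm U) (tlead hm hp S)) (ctranspM M (tcols hp V)).

Definition Gamma n (M : 'M[C]_n) m p k (B : tensor C m p n) : Prop :=
  exists (X : tensor C m k n) (Y : tensor C k p n), B = starM M X Y.

End Tensors.

(* Main.v *)
Require Import Defs.
From HB Require Import structures.
From mathcomp Require Import all_boot all_order all_algebra.
From mathcomp Require Import reals complex ring.

Set Implicit Arguments.
Unset Strict Implicit.
Unset Printing Implicit Defensive.

Import Order.TTheory GRing.Theory Num.Theory.
Local Open Scope ring_scope.

(** The transform reduces the theorem to the Eckart-Young theorem on matrices.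
    If M = c W with W unitary, each tube is mapped by W up to the factor c, so
    |c|^2 times the squared Frobenius norm of a tensor is the sum of the squared
    Frobenius norms of its transformed slices ([sqnorm_scaled_unitary]).  On
    transformed slices the product of tensors is the matrix product, hence the
    transformed slices of a member of Gamma are products of an m x k and a k x p
    matrix, chosen independently from slice to slice, while those of A_k are the
    truncated singular value decompositions of the slices of A.  Minimising
    slice by slice therefore minimises the whole error, and the error is the sum
    over slices of the squares of the discarded singular values, which regroups
    into the tubes of S.

    On one slice ([eckart_young]), unitary invariance replaces the matrix by its
    diagonal factor S.  A product X Y with k inner indices has its rows in the
    span of k orthonormal rows Q, so by Pythagoras its squared distance to S is
    at least |S|^2 - |S Q^*|^2.  Here |S Q^*|^2 is the sum of the s_t^2 weighted
    by the diagonal entries of the projector Q^* Q, which lie in [0, 1] and add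
    up to k; such a weighted sum is at most the sum of the k largest s_t^2
    ([weighted_sum_le]).

    It remains to cut the sum of the squared tubes at the t-rank r, which may
    come from another decomposition of A.  Eckart-Young says that the tail sums
    of the squared singular values are minimal distances, so they depend on the
    slice alone and the diagonal factor is unique ([svd_unique]).  As the
    singular values decrease in every slice, the nonzero tubes form an initial
    segment, which is thus the set of the first r indices ([trankP]). *)

(** * The squared Frobenius norm of a matrix *)

Section FrobeniusNorm.
Local Open Scope sesquilinear_scope.
Variable C : numClosedFieldType.

Lemma adjmxM m n p (A : 'M[C]_(m, n)) (B : 'M[C]_(n, p)) :
  (A *m B)^t* = B^t* *m A^t*.
Proof. by rewrite trmx_mul map_mxM. Qed.

Lemma adjmxB m n (A B : 'M[C]_(m, n)) : (A - B)^t* = A^t* - B^t*.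
Proof. by rewrite linearB /= map_mxB. Qed.

Lemma adjmxK m n (A : 'M[C]_(m, n)) : (A^t*)^t* = A.
Proof. by apply/matrixP => i j; rewrite !mxE conjCK. Qed.

Definition sqnorm m n (A : 'M[C]_(m, n)) : C := \tr (A *m A^t*).

Lemma sqnormE m n (A : 'M[C]_(m, n)) : sqnorm A = \sum_i \sum_j `|A i j| ^+ 2.
Proof.
rewrite /sqnorm /mxtrace; apply: eq_bigr => i _; rewrite mxE.
by apply: eq_bigr => j _; rewrite !mxE normCK.
Qed.

Lemma sqnorm_ge0 m n (A : 'M[C]_(m, n)) : 0 <= sqnorm A.
Proof.
by rewrite sqnormE; do 2!apply: sumr_ge0 => ? _; rewrite exprn_ge0.
Qed.

Lemma sqnormZ m n (c : C) (A : 'M[C]_(m, n)) :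
  sqnorm (c *: A) = `|c| ^+ 2 * sqnorm A.
Proof.
rewrite !sqnormE mulr_sumr; apply: eq_bigr => i _; rewrite mulr_sumr.
by apply: eq_bigr => j _; rewrite mxE normrM exprMn.
Qed.

Lemma sqnorm_unitaryl m n (U : 'M[C]_m) (A : 'M[C]_(m, n)) :
  U \is unitarymx -> sqnorm (U *m A) = sqnorm A.
Proof.
move=> uU; rewrite /sqnorm adjmxM mulmxA mxtrace_mulC !mulmxA.
by rewrite -invmx_unitary // mulVmx ?mul1mx // unitarymx_unit.
Qed.

Lemma sqnorm_adj_unitaryr m n (V : 'M[C]_n) (A : 'M[C]_(m, n)) :
  V \is unitarymx -> sqnorm (A *m V^t*) = sqnorm A.
Proof.
move=> uV; rewrite /sqnorm adjmxM adjmxK !mulmxA -(mulmxA A).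
by rewrite -invmx_unitary // mulVmx ?mulmx1 // unitarymx_unit.
Qed.

(** The rows of Q are orthonormal, so A - X Q splits into the component of A
    orthogonal to these rows and (A Q^* - X) Q, which lies in their span. *)
Lemma sqnorm_pythagoras m k n (Q : 'M[C]_(k, n)) (A : 'M[C]_(m, n))
    (X : 'M[C]_(m, k)) : Q \is unitarymx ->
  sqnorm (A - X *m Q) = sqnorm A - sqnorm (A *m Q^t*) + sqnorm (A *m Q^t* - X).
Proof.
move=> /unitarymxP uQ; rewrite /sqnorm !(adjmxB, adjmxM, adjmxK).
rewrite !(mulmxBl, mulmxBr) !mulmxA -(mulmxA X Q (Q^t*)) uQ mulmx1 !linearB /=.
by ring.
Qed.

Lemma gram_diag_ge0 k n (Q : 'M[C]_(k, n)) j : 0 <= (Q^t* *m Q) j j.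
Proof. by rewrite mxE sumr_ge0 // => b _; rewrite !mxE -normCKC exprn_ge0. Qed.

(** This is Bessel's inequality for the basis vector e_j: the projection of e_j
    on the span of the rows of Q has squared norm (Q^* Q)_jj. *)
Lemma gram_diag_le1 k n (Q : 'M[C]_(k, n)) j :
  Q \is unitarymx -> (Q^t* *m Q) j j <= 1.
Proof.
move=> uQ; pose e : 'rV[C]_n := delta_mx 0 j.
have := sqnorm_ge0 (e - (e *m Q^t*) *m Q).
rewrite sqnorm_pythagoras // subrr [X in _ + X]/sqnorm mul0mx mxtrace0 addr0.
have e_adj : e^t* = delta_mx j 0.
  apply/matrixP => a b; rewrite !mxE andbC.
  by case: (_ && _); rewrite ?conjC1 ?conjC0.
rewrite subr_ge0 {1}/sqnorm adjmxM adjmxK -!mulmxA trace_mx11 -rowE mxE.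
rewrite /sqnorm e_adj mulmxA -colE trace_mx11 mul_delta_mx mxE mxE /=.
by rewrite [X in _ <= X -> _]mxE !eqxx.
Qed.

End FrobeniusNorm.

(** * Sums along the diagonal, and weighted sums *)

Section DiagonalEntries.
Variable C : numClosedFieldType.

(** When S is the diagonal factor of a singular value decomposition, these are
    the singular values. *)
Definition sv m p (S : 'M[C]_(m, p)) (t : 'I_(minn m p)) : C :=
  S (widen_ord (geq_minl m p) t) (widen_ord (geq_minr m p) t).

Lemma sum_offdiag0 m p (F : 'I_m -> 'I_p -> C) :
  (forall (i : 'I_m) (j : 'I_p), i != j :> nat -> F i j = 0) ->
  \sum_i \sum_j F i j =
  \sum_t F (widen_ord (geq_minl m p) t) (widen_ord (geq_minr m p) t).
Proof.
move=> F0; pose h t := (widen_ord (geq_minl m p) t, widen_ord (geq_minr m p) t).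
have h_inj : {in predT &, injective h} by move=> s t _ _ [/val_inj].
rewrite pair_bigA /= (bigID (mem [set h t | t in predT])) /=.
rewrite [X in _ + X]big1 ?addr0 => [|[i j] /= nh].
  by rewrite big_imset.
apply: F0; apply: contraNN nh => /eqP ij; apply/imsetP.
have lti : (i < minn m p)%N by rewrite leq_min ltn_ord ij ltn_ord.
by exists (Ordinal lti) => //; congr pair; apply: val_inj.
Qed.

Lemma card_ord_lt N k : (k <= N)%N -> #|[pred t : 'I_N | (t < k)%N]| = k.
Proof.
move=> kN; have wid_inj : injective (widen_ord kN) by move=> s t [/val_inj].
rewrite -[RHS]card_ord -(card_imset _ wid_inj); apply: eq_card => t.
rewrite inE; apply/idP/imsetP => [tk|[s _ ->]]; last exact: (ltn_ord s).
by exists (Ordinal tk) => //; apply: val_inj.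
Qed.

Lemma mem_initial_segment N (D : {set 'I_N}) :
  (forall s t : 'I_N, (s <= t)%N -> t \in D -> s \in D) ->
  forall t : 'I_N, (t \in D) = (t < #|D|)%N.
Proof.
move=> Dinit t; apply/idP/idP => [tD|].
  rewrite -(card_ord_lt (ltn_ord t)); apply/subset_leq_card/subsetP => s.
  by rewrite inE ltnS => st; apply: Dinit tD.
apply: contraTT => tND; rewrite -leqNgt -(card_ord_lt (ltnW (ltn_ord t))).
apply/subset_leq_card/subsetP => s sD; rewrite inE ltnNge.
by apply: contraNN tND => ts; apply: Dinit sD.
Qed.

(** Moving weight from an index t >= k to an index below k cannot decrease the
    sum.  With a threshold e separating the values before k from those after it,
    this reads (d t - e) * w t <= (d t - e) for t < k and (d t - e) * w t <= 0
    otherwise, the constant e contributing at most e * k. *)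
Lemma weighted_sum_le N k (d w : 'I_N -> C) :
    (k <= N)%N -> (forall t, 0 <= d t) ->
    (forall s t : 'I_N, (s <= t)%N -> d t <= d s) ->
    (forall t, 0 <= w t <= 1) -> \sum_t w t <= k%:R ->
  \sum_t d t * w t <= \sum_(t < N | (t < k)%N) d t.
Proof.
move=> kN d0 dmono w01 wk.
(* The threshold is d k, or 0 when no index follows the first k ones. *)
have [e [e0 elt ege]] : exists e : C,
    [/\ 0 <= e, forall t : 'I_N, (t < k)%N -> e <= d t
              & forall t : 'I_N, (k <= t)%N -> d t <= e].
  have [ltkN|leNk] := ltnP k N.
    exists (d (Ordinal ltkN)); split=> // t tk; apply: dmono => //.
    exact: ltnW.
  exists 0; split=> // t; rewrite leqNgt (leq_trans _ leNk) //.
have -> : \sum_t d t * w t = \sum_t (d t - e) * w t + e * \sum_t w t.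
  rewrite mulr_sumr -big_split /=; apply: eq_bigr => t _ /=.
  by rewrite -mulrDl subrK.
have sum_e : \sum_(t < N | (t < k)%N) e = e * k%:R.
  rewrite sumr_const mulr_natr; congr (_ *+ _).
  exact: card_ord_lt kN.
have -> : \sum_(t < N | (t < k)%N) d t =
    \sum_(t < N | (t < k)%N) (d t - e) + e * k%:R.
  by rewrite sumrB sum_e subrK.
apply: lerD; last by rewrite ler_wpM2l.
rewrite [leRHS]big_mkcond /=; apply: ler_sum => t _.
have /andP[w0 w1] := w01 t; case: ltnP => tk.
  by rewrite ler_piMr // subr_ge0 elt.
by rewrite mulr_le0_ge0 // subr_le0 ege.
Qed.

End DiagonalEntries.

(** * The Eckart-Young theorem for one slice *)

Section EckartYoung.
Local Open Scope sesquilinear_scope.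
Variable C : numClosedFieldType.

Definition svtail m p k (S : 'M[C]_(m, p)) : C :=
  \sum_(t < minn m p | (k <= t)%N) sv S t ^+ 2.

Definition sv_sorted m p (S : 'M[C]_(m, p)) : Prop :=
  [/\ is_diag_mx S, forall t, 0 <= sv S t &
      forall s t : 'I_(minn m p), (s <= t)%N -> sv S t <= sv S s].

Lemma svd_sorted m p (A : 'M[C]_(m, p)) U S V : is_svd A U S V -> sv_sorted S.
Proof.
by move=> [_ [dS S0 Sdec]]; split=> // [t | s t st]; [apply: S0 | apply: Sdec].
Qed.

Lemma sqnorm_diag m p (S : 'M[C]_(m, p)) :
  is_diag_mx S -> sqnorm S = \sum_t `|sv S t| ^+ 2.
Proof.
move=> /is_diag_mxP dS; rewrite sqnormE.
apply: (sum_offdiag0 (F := fun i j => `|S i j| ^+ 2)) => i j ij.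
by rewrite dS // normr0 expr0n.
Qed.

(** Each row of S is a multiple of a basis vector, and the projection of e_j has
    squared norm (Q^* Q)_jj. *)
Lemma sqnorm_diag_proj m p k (S : 'M[C]_(m, p)) (Q : 'M[C]_(k, p)) :
  is_diag_mx S ->
  sqnorm (S *m Q^t*) =
  \sum_t `|sv S t| ^+ 2 *
    (Q^t* *m Q) (widen_ord (geq_minr m p) t) (widen_ord (geq_minr m p) t).
Proof.
move=> dS; have /is_diag_mxP S0 := dS.
rewrite /sqnorm adjmxM adjmxK mulmxA -(mulmxA S) /mxtrace.
under eq_bigr => i _ do rewrite mxE.
rewrite (sum_offdiag0 (F := fun i j => (S *m (Q^t* *m Q)) i j * S^t* j i)).
  apply: eq_bigr => t _; rewrite mxE (bigD1 (widen_ord (geq_minr m p) t)) //=.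
  rewrite big1 ?addr0 => [|j jt]; first by rewrite !mxE mulrAC -normCK.
  rewrite S0 ?mul0r // eq_sym; apply: contraNneq jt => /= tj.
  exact/eqP/val_inj.
by move=> i j ij; rewrite !mxE S0 // conjC0 mulr0.
Qed.

(** Orthonormalising the rows of Y reduces to a factor Q with orthonormal rows;
    by Pythagoras the best X is then S Q^*, and only the norm captured by the
    projector Q^* Q has to be bounded. *)
Lemma eckart_young_diag m p k (S : 'M[C]_(m, p))
    (X : 'M[C]_(m, k)) (Y : 'M[C]_(k, p)) :
  (k <= minn m p)%N -> sv_sorted S -> svtail k S <= sqnorm (S - X *m Y).
Proof.
move=> kmp [dS S0 Sdec].
have kp : (k <= p)%N := leq_trans kmp (geq_minr m p).
have uQ := schmidt_unitarymx Y kp.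
have /submxP[Z ->] := schmidt_sub Y; set Q := schmidt Y in uQ *.
rewrite mulmxA sqnorm_pythagoras //.
have sq_sv t : `|sv S t| ^+ 2 = sv S t ^+ 2 by rewrite ger0_norm.
have sqS : sqnorm S = svtail k S + \sum_(t < minn m p | (t < k)%N) sv S t ^+ 2.
  rewrite sqnorm_diag // (bigID (fun t : 'I__ => (k <= t)%N)) /=.
  congr (_ + _); first exact: eq_bigr.
  by apply: eq_big => [t|t _]; rewrite ?ltnNge.
have proj_le : sqnorm (S *m Q^t*) <= \sum_(t < minn m p | (t < k)%N) sv S t ^+ 2.
  rewrite sqnorm_diag_proj //; under eq_bigr => t _ do rewrite sq_sv.
  apply: weighted_sum_le => // [t | s t st | t |].
  - by rewrite exprn_ge0.
  - by rewrite lerXn2r ?nnegrE ?S0 ?Sdec.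
  - by rewrite gram_diag_ge0 gram_diag_le1.
  (* The trace of a projector of rank k. *)
  have -> : k%:R = \sum_j (Q^t* *m Q) j j :> C.
    by rewrite -[RHS]mxtrace_mulC (unitarymxP uQ) mxtrace1.
  have wid_inj : {in predT &, injective (widen_ord (geq_minr m p))}.
    by move=> s t _ _ [/val_inj].
  rewrite -(big_imset (fun j => (Q^t* *m Q) j j) wid_inj) /=.
  rewrite [leRHS](bigID (mem [set widen_ord (geq_minr m p) t | t in predT])) /=.
  by rewrite lerDl sumr_ge0 // => j _; apply: gram_diag_ge0.
rewrite sqS -addrA -[leLHS]addr0 -addrA lerD2l addrA.
by rewrite addr_ge0 ?sqnorm_ge0 ?subr_ge0.
Qed.

Section Truncation.
Variables (m p k : nat) (hm : (k <= m)%N) (hp : (k <= p)%N).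

Definition mxtrunc (U : 'M[C]_m) (S : 'M[C]_(m, p)) (V : 'M[C]_p) :=
  colsub (widen_ord hm) U *m mxsub (widen_ord hm) (widen_ord hp) S *m
  (colsub (widen_ord hp) V)^t*.

Lemma colsub_rowsub1 n (kn : (k <= n)%N) :
  colsub (widen_ord kn) 1%:M *m rowsub (widen_ord kn) 1%:M = pid_mx k :> 'M[C]_n.
Proof.
apply/matrixP => i j; rewrite !mxE; case: (ltnP i k) => ik; last first.
  rewrite andbF big1 // => a _; rewrite !mxE -val_eqE /= gtn_eqF ?mul0r //.
  exact: leq_trans ik.
rewrite andbT (bigD1 (Ordinal ik)) //= big1 => [|a ai]; last first.
  by rewrite !mxE -val_eqE /= eq_sym (negPf (ai : val a != i)) mul0r.
by rewrite !mxE -!val_eqE /= eqxx mul1r addr0.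
Qed.

(** Writing the truncation with full-size factors makes unitary invariance
    applicable to its difference with U S V^*. *)
Lemma mxtruncE U S V :
  mxtrunc U S V = U *m (pid_mx k *m S *m pid_mx k) *m V^t*.
Proof.
have -> : mxtrunc U S V =
    (U *m colsub (widen_ord hm) 1%:M) *m
    (rowsub (widen_ord hm) 1%:M *m S *m colsub (widen_ord hp) 1%:M) *m
    (rowsub (widen_ord hp) 1%:M *m V^t*).
  rewrite -rowsubE mulmx_colsub mulmx1 mulmx_colsub mulmx1 -rowsubE.
  by congr (_ *m _ *m _); apply/matrixP => i j; rewrite !mxE.
by rewrite -!colsub_rowsub1 !mulmxA.
Qed.

Lemma pid_mul_entry (S : 'M[C]_(m, p)) i j :
  (pid_mx k *m S *m pid_mx k) i j = S i j *+ ((i < k)%N && (j < k)%N).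
Proof.
rewrite mxE (bigD1 j) //= big1 => [|a aj]; last first.
  by rewrite [X in _ * X]mxE (negPf (aj : val a != val j)) mulr0.
rewrite mxE (bigD1 i) //= big1 => [|a ai]; last first.
  by rewrite [X in X * _]mxE eq_sym (negPf (ai : val a != val i)) mul0r.
rewrite ![pid_mx _ _ _]mxE !eqxx !addr0 /= -mulrA mulr_natl mulr_natr -mulrnA.
by rewrite mulnb andbC.
Qed.

Lemma svd_trunc_error A U S V :
  is_svd A U S V -> sqnorm (A - mxtrunc U S V) = svtail k S.
Proof.
move=> svdA; have [dS S0 _] := svd_sorted svdA; case: svdA => -[uU uV ->] _.
rewrite mxtruncE -mulmxBl -mulmxBr sqnorm_adj_unitaryr // sqnorm_unitaryl //.
have S0' := is_diag_mxP dS.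
rewrite sqnorm_diag; last first.
  apply/is_diag_mxP => i j ij.
  by rewrite mxE [X in _ + X]mxE pid_mul_entry S0' // mul0rn subr0.
rewrite /svtail [RHS]big_mkcond /=; apply: eq_bigr => t _.
rewrite /sv mxE [X in _ + X]mxE pid_mul_entry /= andbb -/(sv S t).
case: ltnP => _; first by rewrite subrr normr0 expr0n.
by rewrite subr0 ger0_norm.
Qed.

End Truncation.

Lemma eckart_young m p k A U S V (X : 'M[C]_(m, k)) (Y : 'M[C]_(k, p)) :
  (k <= minn m p)%N -> is_svd A U S V -> svtail k S <= sqnorm (A - X *m Y).
Proof.
move=> kmp svdA; have sS := svd_sorted svdA; case: svdA => -[uU uV ->] _.
have -> : X *m Y = U *m ((U^t* *m X) *m (Y *m V)) *m V^t*.
  rewrite -!invmx_unitary // !mulmxA mulmxV ?unitarymx_unit // mul1mx.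
  by rewrite mulmxK ?unitarymx_unit.
rewrite -mulmxBl -mulmxBr sqnorm_adj_unitaryr // sqnorm_unitaryl //.
exact: eckart_young_diag.
Qed.

Lemma svtailS m p (S : 'M[C]_(m, p)) (t : 'I_(minn m p)) :
  svtail t S = sv S t ^+ 2 + svtail t.+1 S.
Proof.
rewrite /svtail (bigD1 t) //=; congr (_ + _); apply: eq_bigl => s.
by rewrite ltn_neqAle andbC [in RHS]eq_sym.
Qed.

(** The truncation of one decomposition competes in the minimisation problem
    solved by the other one, so both have the same tails; the squared singular
    values are the differences of consecutive tails. *)
Lemma svd_unique m p (A : 'M[C]_(m, p)) U S V U' S' V' :
  is_svd A U S V -> is_svd A U' S' V' -> S = S'.
Proof.
move=> svdA svdA'; have [dS S0 _] := svd_sorted svdA.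
have [dS' S0' _] := svd_sorted svdA'.
have tail_le k U1 S1 V1 U2 S2 V2 : (k <= minn m p)%N ->
    is_svd A U1 S1 V1 -> is_svd A U2 S2 V2 -> svtail k S1 <= svtail k S2.
  move=> kmp svd1 svd2; have hm := leq_trans kmp (geq_minl m p).
  have hp := leq_trans kmp (geq_minr m p).
  by rewrite -(svd_trunc_error hm hp svd2); apply: eckart_young svd1.
have tail_eq k : (k <= minn m p)%N -> svtail k S = svtail k S'.
  move=> kmp; apply: le_anti; apply/andP; split.
    exact: tail_le kmp svdA svdA'.
  exact: tail_le kmp svdA' svdA.
have svE t : sv S t = sv S' t.
  apply/eqP; rewrite -(@eqrXn2 _ 2) ?S0 ?S0' //; apply/eqP.
  have := tail_eq t (ltnW (ltn_ord t)).
  by rewrite !svtailS (tail_eq t.+1) // => /addIr.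
apply/matrixP => i j; have [ij|ij] := eqVneq (i : nat) j; last first.
  by rewrite (is_diag_mxP dS) // (is_diag_mxP dS').
have lti : (i < minn m p)%N by rewrite leq_min ltn_ord ij ltn_ord.
have := svE (Ordinal lti); rewrite /sv.
have -> : widen_ord (geq_minl m p) (Ordinal lti) = i by apply: val_inj.
by have -> : widen_ord (geq_minr m p) (Ordinal lti) = j by apply: val_inj.
Qed.

End EckartYoung.

(** * Tensors and their transformed slices *)

Section Tensors.
Local Open Scope sesquilinear_scope.
Variable C : numClosedFieldType.

Lemma mode3E m p n (A : tensor C m p n) (M : 'M[C]_n) k i j :
  mode3 A M k i j = \sum_l M k l * A l i j.
Proof. by rewrite ffunE mxE. Qed.

Lemma mode3_comp m p n (A : tensor C m p n) (M N : 'M[C]_n) :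
  mode3 (mode3 A M) N = mode3 A (N *m M).
Proof.
apply/ffunP => k; apply/matrixP => i j; rewrite !mode3E.
under eq_bigr => l _ do rewrite mode3E mulr_sumr.
rewrite exchange_big /=; apply: eq_bigr => l _; rewrite mxE mulr_suml.
by apply: eq_bigr => a _; rewrite mulrA.
Qed.

Lemma mode3_1 m p n (A : tensor C m p n) : mode3 A 1%:M = A.
Proof.
apply/ffunP => k; apply/matrixP => i j; rewrite mode3E (bigD1 k) //=.
rewrite big1 => [|l lk]; last by rewrite mxE eq_sym (negPf lk) mul0r.
by rewrite mxE eqxx mul1r addr0.
Qed.

Lemma mode3B m p n (A B : tensor C m p n) (M : 'M[C]_n) l :
  mode3 (A - B) M l = mode3 A M l - mode3 B M l.
Proof.
apply/matrixP => i j; rewrite [RHS]mxE [(- mode3 B M l)%R i j]mxE !mode3E -sumrB.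
by apply: eq_bigr => a _; rewrite !ffunE !mxE mulrBr.
Qed.

Lemma mode3_tcols m p n k (kp : (k <= p)%N) (A : tensor C m p n) M l :
  mode3 (tcols kp A) M l = colsub (widen_ord kp) (mode3 A M l).
Proof.
apply/matrixP => i j; rewrite [RHS]mxE !mode3E.
by apply: eq_bigr => a _; rewrite ffunE mxE.
Qed.

Lemma mode3_tlead m p n k (km : (k <= m)%N) (kp : (k <= p)%N)
    (A : tensor C m p n) M l :
  mode3 (tlead km kp A) M l =
  mxsub (widen_ord km) (widen_ord kp) (mode3 A M l).
Proof.
apply/matrixP => i j; rewrite [RHS]mxE !mode3E.
by apply: eq_bigr => a _; rewrite ffunE mxE.
Qed.

Lemma mode3_dtube m p n (S : tensor C m p n) t M l :
  mode3 (dtube S t) M l = const_mx (sv (mode3 S M l) t).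
Proof.
apply/matrixP => i j; rewrite [RHS]mxE /sv !mode3E.
by apply: eq_bigr => a _; rewrite ffunE mxE.
Qed.

Lemma fnorm_ge0 m p n (A : tensor C m p n) : 0 <= fnorm A.
Proof.
by rewrite sqrtC_ge0; do 3!apply: sumr_ge0 => ? _; rewrite exprn_ge0.
Qed.

Lemma fnorm_sq m p n (A : tensor C m p n) :
  fnorm A ^+ 2 = \sum_i \sum_j \sum_l `|A l i j| ^+ 2.
Proof. exact: sqrtCK. Qed.

Section InvertibleTransform.
Variables (n : nat) (M : 'M[C]_n).
Hypothesis unitM : M \in unitmx.

Lemma mode3_inj m p : injective (fun A : tensor C m p n => mode3 A M).
Proof.
move=> A B /(congr1 (fun D => mode3 D (invmx M))).
by rewrite !mode3_comp mulVmx // !mode3_1.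
Qed.

Lemma mode3_starM m p q (A : tensor C m p n) (B : tensor C p q n) l :
  mode3 (starM M A B) M l = mode3 A M l *m mode3 B M l.
Proof. by rewrite mode3_comp mulmxV // mode3_1 ffunE. Qed.

Lemma mode3_ctranspM m p (A : tensor C m p n) l :
  mode3 (ctranspM M A) M l = (mode3 A M l)^t*.
Proof. by rewrite mode3_comp mulmxV // mode3_1 ffunE. Qed.

Lemma mode3_ttrunc m p k (kmp : (k <= minn m p)%N) (U : tensor C m m n)
    (S : tensor C m p n) (V : tensor C p p n) l :
  mode3 (ttrunc M kmp U S V) M l =
  mxtrunc (leq_trans kmp (geq_minl m p)) (leq_trans kmp (geq_minr m p))
    (mode3 U M l) (mode3 S M l) (mode3 V M l).
Proof.
by rewrite !mode3_starM mode3_ctranspM !mode3_tcols mode3_tlead.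
Qed.

Lemma tsvdm_unique m p (A : tensor C m p n) U S V U' S' V' :
  is_tsvdm M A U S V -> is_tsvdm M A U' S' V' -> S = S'.
Proof.
move=> [_ svdA] [_ svdA']; apply: mode3_inj; apply/ffunP => l.
exact: svd_unique (svdA l) (svdA' l).
Qed.

Lemma dtube_eq0 m p (S : tensor C m p n) t :
  (dtube S t == 0) = [forall l, sv (mode3 S M l) t == 0].
Proof.
have mode0 : mode3 (0 : tensor C 1 1 n) M = 0.
  by apply/ffunP => l; rewrite -[in LHS](subrr 0) mode3B subrr ffunE.
rewrite -(inj_eq (@mode3_inj 1 1)) /= mode0; apply/eqP/forallP => [S0 l|S0].
  have /matrixP/(_ 0 0) : const_mx (sv (mode3 S M l) t) = 0 :> 'M[C]_1.
    by rewrite -mode3_dtube S0 ffunE.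
  by rewrite !mxE => ->.
apply/ffunP => l; rewrite mode3_dtube (eqP (S0 l)) ffunE.
by apply/matrixP => i j; rewrite !mxE.
Qed.

End InvertibleTransform.

(** A unitary matrix preserves the norm of every tube; tubes and slices are two
    ways of grouping the same entries. *)
Lemma sqnorm_scaled_unitary n m p (c : C) (W : 'M[C]_n) (A : tensor C m p n) :
  W \is unitarymx ->
  \sum_l sqnorm (mode3 A (c *: W) l) = `|c| ^+ 2 * fnorm A ^+ 2.
Proof.
move=> uW; under eq_bigr => l _ do rewrite sqnormE.
rewrite fnorm_sq exchange_big mulr_sumr; apply: eq_bigr => i _ /=.
rewrite exchange_big mulr_sumr; apply: eq_bigr => j _ /=.
pose a : 'cV[C]_n := \col_l A l i j.
have sq_col (v : 'cV[C]_n) : sqnorm v = \sum_l `|v l 0| ^+ 2.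
  by rewrite sqnormE; apply: eq_bigr => l _; rewrite big_ord1.
transitivity (sqnorm (c *: W *m a)).
  rewrite sq_col; apply: eq_bigr => l _; rewrite mode3E mxE.
  by congr (`|_| ^+ 2); apply: eq_bigr => b _; rewrite [a _ _]mxE.
rewrite -scalemxAl sqnormZ sqnorm_unitaryl // sq_col.
by congr (_ * _); apply: eq_bigr => l _; rewrite mxE.
Qed.

(** * Best approximation under a multiple of a unitary transform *)

Section ScaledUnitaryTransform.
Variables (m p n : nat) (M : 'M[C]_n) (c : C) (W : 'M[C]_n).
Hypotheses (c0 : c != 0) (uW : W \is unitarymx) (defM : M = c *: W).

Lemma scaled_unitary_unit : M \in unitmx.
Proof. by rewrite defM unitmxZ ?unitfE // unitarymx_unit. Qed.
Let unitM := scaled_unitary_unit.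

Variables (A : tensor C m p n) (U : tensor C m m n) (S : tensor C m p n).
Variables (V : tensor C p p n).
Hypothesis tsvdA : is_tsvdm M A U S V.

(** The transformed singular values decrease in every slice, so a vanishing tube
    forces all later tubes to vanish; the number of nonzero tubes then tells
    which ones they are. *)
Lemma trankP r t : is_trank M A r -> (dtube S t != 0) = (t < r)%N.
Proof.
move=> [U' [S' [V' [tsvdA' ->]]]].
rewrite -(tsvdm_unique unitM tsvdA tsvdA') -mem_initial_segment ?inE // => i j ij.
rewrite !inE !(dtube_eq0 unitM); apply: contraNN => /forallP Si0.
apply/forallP => l; have [_ S0 Sdec] := svd_sorted (tsvdA.2 l).
by rewrite eq_le S0 andbT -(eqP (Si0 l)) Sdec.
Qed.

Variables (k : nat) (kmp : (k <= minn m p)%N).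

Lemma ttrunc_error_slices :
  `|c| ^+ 2 * fnorm (A - ttrunc M kmp U S V) ^+ 2 =
  \sum_l svtail k (mode3 S M l).
Proof.
rewrite -(sqnorm_scaled_unitary _ _ uW) -defM; apply: eq_bigr => l _.
by rewrite mode3B mode3_ttrunc // (svd_trunc_error _ _ (tsvdA.2 l)).
Qed.

Lemma ttrunc_error :
  fnorm (A - ttrunc M kmp U S V) ^+ 2 =
  \sum_(t < minn m p | (k <= t)%N) fnorm (dtube S t) ^+ 2.
Proof.
have c2 : `|c| ^+ 2 != 0 by rewrite expf_neq0 ?normr_eq0.
apply: (mulfI c2); rewrite ttrunc_error_slices exchange_big mulr_sumr /=.
apply: eq_bigr => t _; rewrite -(sqnorm_scaled_unitary _ _ uW) -defM.
apply: eq_bigr => l _; rewrite mode3_dtube sqnormE !big_ord1 mxE.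
by have [_ S0 _] := svd_sorted (tsvdA.2 l); rewrite ger0_norm.
Qed.

Lemma ttrunc_optimal (B : tensor C m p n) :
  Gamma M k B -> fnorm (A - ttrunc M kmp U S V) <= fnorm (A - B).
Proof.
move=> [X [Y ->]]; rewrite -(@ler_pXn2r _ 2) ?nnegrE ?fnorm_ge0 //.
have c2 : 0 < `|c| ^+ 2 by rewrite exprn_gt0 ?normr_gt0.
rewrite -(ler_pM2l c2) ttrunc_error_slices.
rewrite -(sqnorm_scaled_unitary _ _ uW) -defM; apply: ler_sum => l _.
by rewrite mode3B mode3_starM //; apply: eckart_young (tsvdA.2 l).
Qed.

End ScaledUnitaryTransform.
End Tensors.

Theorem theorem4p7 (R : realType) (m p n : nat)
    (M : 'M[R[i]]_n)
    (hM : exists (c : R[i]) (W : 'M[R[i]]_n),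
        [/\ c != 0, W \is unitarymx & M = c *: W])
    (A : tensor R[i] m p n)
    (U : tensor R[i] m m n) (S : tensor R[i] m p n) (V : tensor R[i] p p n)
    (hA : is_tsvdm M A U S V)
    (r : nat) (hr : is_trank M A r)
    (k : nat) (hk1 : (1 <= k)%N) (hk : (k <= minn m p)%N) :
  [/\ Gamma M k (ttrunc M hk U S V),
      forall B : tensor R[i] m p n, Gamma M k B ->
        fnorm (A - ttrunc M hk U S V) <= fnorm (A - B) &
      fnorm (A - ttrunc M hk U S V) ^+ 2 =
        \sum_(i < minn m p | (k <= i < r)%N) fnorm (dtube S i) ^+ 2].
Proof.
have [c [W [c0 uW defM]]] := hM; split.
- by eexists; eexists.
- by move=> B; apply: (ttrunc_optimal c0 uW defM hA).
rewrite (ttrunc_error c0 uW defM hA) big_mkcond [RHS]big_mkcond /=.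
apply: eq_bigr => t _; rewrite -(trankP c0 uW defM hA t hr).
case: leqP => //= _; case: eqP => // ->.
rewrite fnorm_sq; do 3![apply: big1 => ? _].
by rewrite ffunE mxE normr0 expr0n.
Qed.
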